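(* Let $k\geq 4$ be an integer and let $M$ be a simple minimally $k$-degenerate matroid. Then $|E(M)|\leq (k-1)(r(M)-1)+2$. Moreover, equality is attained if and only if $M\cong U_{2,k+1}$ or $M\cong U_{2,k+1}\oplus_2 U_{2,k+1}$.
   Context: All matroids are finite, loopless, with non-empty ground set; all restrictions considered are non-empty. The cogirth $g^*(M)$ is the size of a smallest cocircuit of $M$. For an integer $k\geq 2$, a loopless matroid $M$ is minimally $k$-degenerate if $g^*(M)=k$ and every proper (non-empty) restriction of $M$ has cogirth at most $k-1$. $U_{r,n}$ denotes the uniform matroid of rank $r$ on $n$ elements. If $E(M_1)\cap E(M_2)=\{p\}$, $|E(M_1)|,|E(M_2)|\ge 3$, and $p$ is neither a loop nor a coloop of $M_1$ or $M_2$, the $2$-sum $M_1\oplus_2 M_2$ at basepoint $p$ is the matroid on $(E(M_1)\cup E(M_2))-\{p\}$ whose circuits are the circuits of $M_1$ avoiding $p$, the circuits of $M_2$ avoiding $p$, and the sets $(C_1\cup C_2)-\{p\}$ where $C_i$ is a circuit of $M_i$ containing $p$ for $i=1,2$. Up to isomorphism, $U_{2,k+1}\oplus_2 U_{2,k+1}$ (for two copies sharing exactly one element) does not depend on the choice of basepoint. *)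

(* Defs.v *)
From mathcomp Require Import all_boot.

Set Implicit Arguments.
Unset Strict Implicit.
Unset Printing Implicit Defensive.

(* The ground set is a subset of [T], so that several matroids (as in a 2-sum)
   may live on overlapping ground sets. *)
Record matroid (T : finType) := Matroid {
  ground : {set T};
  indep : {set {set T}};
  indep_ground : forall I : {set T}, I \in indep -> I \subset ground;
  indep0 : set0 \in indep;
  indepS : forall I J : {set T}, J \in indep -> I \subset J -> I \in indep;
  indep_aug : forall I J : {set T}, I \in indep -> J \in indep -> #|I| < #|J| ->
    exists2 x, x \in J :\: I & x |: I \in indep }.

Section Basics.
Variables (T : finType) (M : matroid T).

Definition base (B : {set T}) : bool := maxset (fun I => I \in indep M) B.

Definition rank (A : {set T}) : nat :=
  \max_(I in indep M | I \subset A) #|I|.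

Definition rk : nat := rank (ground M).

Definition circuit (C : {set T}) : bool :=
  minset (fun D => (D \subset ground M) && (D \notin indep M)) C.

Definition loop (e : T) : bool := circuit [set e].

Definition parallel (e f : T) : bool := (e != f) && circuit [set e; f].

Definition loopless : Prop := forall e, ~~ loop e.

Definition simple : Prop := loopless /\ forall e f, ~~ parallel e f.

Lemma base_indep (B : {set T}) : base B -> B \in indep M.
Proof. by case/maxsetP. Qed.

Lemma indep_base_card (I B : {set T}) : I \in indep M -> base B -> #|I| <= #|B|.
Proof.
move=> iI /maxsetP[iB maxB]; rewrite leqNgt; apply/negP => ltBI.
have [x /setDP[_ xB] ixB] := indep_aug iB iI ltBI.
by have := maxB _ ixB (subsetUr _ _); move/setP/(_ x); rewrite setU11 (negPf xB).
Qed.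

Lemma base_extend (I B : {set T}) : I \in indep M -> base B ->
  exists B' : {set T}, [/\ base B', I \subset B' & B' \subset I :|: B].
Proof.
move=> iI bB.
pose P := fun J : {set T} => (J \in indep M) && (J \subset I :|: B).
have PI : P I by rewrite /P iI subsetUl.
have [B' /maxsetP[/andP[iB' sB'] maxB'] sIB'] := maxset_exists PI.
exists B'; split=> //.
have leB : #|B| <= #|B'|.
  rewrite leqNgt; apply/negP => lt.
  have [x /setDP[xB xB'] ix] := indep_aug iB' (base_indep bB) lt.
  have Px : P (x |: B') by rewrite /P ix subUset sB' sub1set inE xB orbT.
  have := maxB' _ Px (subsetUr _ _).
  by move/setP/(_ x); rewrite setU11 (negPf xB').
apply/maxsetP; split=> // D iD sBD; apply/esym/eqP; rewrite eqEcard sBD /=.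
exact: leq_trans (indep_base_card iD bB) leB.
Qed.

End Basics.

Section Restriction.
Variables (T : finType) (M : matroid T) (A : {set T}).

Let rindep : {set {set T}} := [set I in indep M | I \subset A].

Let rindep_ground (I : {set T}) : I \in rindep -> I \subset ground M :&: A.
Proof. by rewrite inE subsetI => /andP[/indep_ground-> ->]. Qed.

Let rindep0 : set0 \in rindep.
Proof. by rewrite inE indep0 sub0set. Qed.

Let rindepS (I J : {set T}) : J \in rindep -> I \subset J -> I \in rindep.
Proof.
rewrite !inE => /andP[iJ sJA] sIJ.
by rewrite (indepS iJ sIJ) (subset_trans sIJ sJA).
Qed.

Let rindep_aug (I J : {set T}) : I \in rindep -> J \in rindep -> #|I| < #|J| ->
  exists2 x, x \in J :\: I & x |: I \in rindep.
Proof.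
rewrite !inE => /andP[iI sIA] /andP[iJ sJA] /(indep_aug iI iJ)[x xJI ix].
exists x => //; rewrite inE ix subUset sIA sub1set andbT.
by case/setDP: xJI => /(subsetP sJA).
Qed.

Definition restrict : matroid T :=
  Matroid rindep_ground rindep0 rindepS rindep_aug.

End Restriction.

Section Dual.
Variables (T : finType) (M : matroid T).

(* [I] is independent in the dual iff it lies in the complement of a base. *)
Let dindep : {set {set T}} :=
  [set I : {set T} | [exists B, base M B && (I \subset ground M :\: B)]].

Let dindepP (I : {set T}) :
  reflect (exists2 B, base M B & I \subset ground M :\: B) (I \in dindep).
Proof.
rewrite inE; apply: (iffP existsP) => [[B /andP[? ?]]|[B ? ?]]; exists B => //.
exact/andP.
Qed.

Let dindep_ground (I : {set T}) : I \in dindep -> I \subset ground M.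
Proof. by case/dindepP => B _ /subset_trans; apply; apply: subsetDl. Qed.

Let dindep0 : set0 \in dindep.
Proof.
have [B bB _] := @maxset_exists _ (fun I => I \in indep M) _ (indep0 M).
by apply/dindepP; exists B; rewrite ?sub0set.
Qed.

Let dindepS (I J : {set T}) : J \in dindep -> I \subset J -> I \in dindep.
Proof.
case/dindepP=> B bB sJ sIJ; apply/dindepP; exists B => //.
exact: subset_trans sJ.
Qed.

Let dindep_aug (I J : {set T}) : I \in dindep -> J \in dindep -> #|I| < #|J| ->
  exists2 x, x \in J :\: I & x |: I \in dindep.
Proof.
case/dindepP=> BI bBI; rewrite subsetD => /andP[sIE dI].
case/dindepP=> BJ bBJ; rewrite subsetD => /andP[sJE dJ] ltIJ.
have iD : BJ :\: I \in indep M := indepS (base_indep bBJ) (subsetDl _ _).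
have [B [bB sDB sBU]] := base_extend iD bBI.
have dIB : [disjoint I & B].
  rewrite disjoint_sym; apply: disjointWl sBU _.
  rewrite -setI_eq0 setIUl setU_eq0 !setI_eq0.
  by rewrite [[disjoint BI & I]]disjoint_sym dI andbT -setI_eq0 setIDAC setDIl
             setDv setI0.
have [sJB|/subsetPn[x xJI xB]] := boolP (J :\: I \subset B); last first.
  exists x => //; apply/dindepP; exists B => //.
  rewrite subsetD subUset sIE sub1set andbT.
  have /setDP[/(subsetP sJE)-> _] := xJI.
  rewrite /= -setI_eq0 setIUl setU_eq0 !setI_eq0 dIB andbT.
  by rewrite disjoints1.
have cB : #|B| <= #|BJ| := indep_base_card (base_indep bB) bBJ.
have dd : [disjoint J :\: I & BJ :\: I].
  apply: disjointWl (subsetDl _ _) _; apply: disjointWr (subsetDl _ _) _.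
  exact: dJ.
have le1 : #|J :\: I| + #|BJ :\: I| <= #|B|.
  rewrite -cardsUI (disjoint_setI0 dd) cards0 addn0 subset_leq_card //.
  by rewrite subUset sJB sDB.
have le2 : #|J :&: I| + #|BJ :&: I| <= #|I|.
  rewrite -cardsUI setIACA (disjoint_setI0 dJ) set0I cards0 addn0.
  by rewrite subset_leq_card // subUset !subsetIr.
have := leq_add (leq_trans le1 cB) le2.
rewrite addnACA [#|J :\: I| + _]addnC [#|BJ :\: I| + _]addnC !cardsID.
by rewrite addnC leq_add2l leqNgt ltIJ.
Qed.

Definition dual : matroid T := Matroid dindep_ground dindep0 dindepS dindep_aug.

Definition cocircuit (C : {set T}) : bool := circuit dual C.

Definition coloop (e : T) : bool := loop dual e.

(* Every cocircuit lies in the ground set, so the unit [#|ground M|] of the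
   minimum only matters for matroids without cocircuits, i.e. those of rank 0;
   a loopless matroid with a non-empty ground set has positive rank. *)
Definition cogirth : nat :=
  \big[minn/#|ground M|]_(C | cocircuit C) #|C|.

End Dual.

Definition minimally_degenerate (T : finType) (k : nat) (M : matroid T) : Prop :=
  [/\ ground M != set0, loopless M, cogirth M = k &
      forall A : {set T}, A \proper ground M -> A != set0 ->
        cogirth (restrict M A) <= k - 1].

Section Uniform.
Variables r n : nat.

Let uindep : {set {set 'I_n}} := [set I : {set 'I_n} | #|I| <= r].

Let uindep_ground (I : {set 'I_n}) : I \in uindep -> I \subset [set: 'I_n].
Proof. by rewrite subsetT. Qed.

Let uindep0 : set0 \in uindep.
Proof. by rewrite inE cards0. Qed.

Let uindepS (I J : {set 'I_n}) : J \in uindep -> I \subset J -> I \in uindep.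
Proof. by rewrite !inE => cJ /subset_leq_card/leq_trans; apply. Qed.

Let uindep_aug (I J : {set 'I_n}) : I \in uindep -> J \in uindep -> #|I| < #|J| ->
  exists2 x, x \in J :\: I & x |: I \in uindep.
Proof.
rewrite !inE => _ cJ ltIJ.
have /subsetPn[x xJ xI] : ~~ (J \subset I).
  by apply/negP => /subset_leq_card; rewrite leqNgt ltIJ.
exists x; first by rewrite inE xI.
by rewrite inE cardsU1 xI (leq_trans ltIJ).
Qed.

(* U_{r,n}, for r <= n. *)
Definition uniform : matroid 'I_n :=
  Matroid uindep_ground uindep0 uindepS uindep_aug.

End Uniform.

Definition isomorphic (T T' : finType) (M : matroid T) (N : matroid T') : Prop :=
  exists f : T -> T',
    [/\ {in ground M &, injective f}, f @: ground M = ground N &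
        forall A : {set T}, A \subset ground M ->
          (f @: A \in indep N) = (A \in indep M)].

(* [N] is the 2-sum of [M1] and [M2] at basepoint [p]; a matroid is determined
   by its ground set and circuits, so there is at most one such [N]. *)
Definition is_two_sum (T : finType) (M1 M2 : matroid T) (p : T) (N : matroid T)
    : Prop :=
  [/\ ground M1 :&: ground M2 = [set p],
      3 <= #|ground M1| /\ 3 <= #|ground M2|,
      [/\ ~~ loop M1 p, ~~ coloop M1 p, ~~ loop M2 p & ~~ coloop M2 p],
      ground N = (ground M1 :|: ground M2) :\ p &
      forall C : {set T}, circuit N C <->
        [\/ circuit M1 C /\ p \notin C,
            circuit M2 C /\ p \notin C |
            exists C1 C2 : {set T},
              [/\ circuit M1 C1, p \in C1, circuit M2 C2, p \in C2 &
                  C = (C1 :|: C2) :\ p]]].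

(* [M] is isomorphic to a 2-sum of a copy of [N1] and a copy of [N2] that share
   exactly one element. *)
Definition isomorphic_two_sum (T T1 T2 : finType)
    (M : matroid T) (N1 : matroid T1) (N2 : matroid T2) : Prop :=
  exists (T' : finType) (M1 M2 N : matroid T') (p : T'),
    [/\ isomorphic M1 N1, isomorphic M2 N2, is_two_sum M1 M2 p N &
        isomorphic M N].

(* Main.v *)
(** Removing a smallest cocircuit of each successive restriction lowers the rank
    and costs k elements once and at most k - 1 elements afterwards; a simple
    matroid of rank 1 has one element, whence the bound, and in the same way
    |X| <= (k - 1) (r(X) - 1) + 1 for every proper non-empty subset X.

    Assume that the bound is attained, and call X tight if it is proper and
    non-empty and satisfies the last inequality with equality.  By submodularity
    intersecting tight sets whose union is not E have tight union and
    intersection; every E - e is tight; a tight set of rank at least 2 contains a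
    tight set of rank one less, hence a tight line (with k points).  Let r >= 3.
    Every e lies off a tight hyperplane, and since k >= 4 this forces each tight
    line L to be a cocircuit: E - L is a tight hyperplane.  Then a descent on the
    rank shows that no tight set contains two tight lines.  Take a tight line L
    and a tight line L' in E - L.  An element e outside both would give the tight
    set E - e with two tight lines, so E is the disjoint union of L and L', r = 3,
    and M is the 2-sum of two copies of U_{2,k+1}. *)
Require Import Defs.
From mathcomp Require Import all_boot zify.

Set Implicit Arguments.
Unset Strict Implicit.
Unset Printing Implicit Defensive.

(** * Rank function, with duality and cogirth expressed through it *)

Section Rank.
Variables (T : finType) (M : matroid T).
Implicit Types A B C D I J : {set T}.

Lemma indep_rank I A : I \in indep M -> I \subset A -> #|I| <= rank M A.
Proof. by move=> iI sIA; rewrite /rank (bigmax_sup I) ?iI. Qed.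

Lemma rank_indepE A : exists I, [/\ I \in indep M, I \subset A & #|I| = rank M A].
Proof.
have PI : (set0 \in indep M) && (set0 \subset A) by rewrite indep0 sub0set.
have [I /andP[iI sIA] eI] :=
  @eq_bigmax_cond _ (fun I => (I \in indep M) && (I \subset A)) (fun I => #|I|)
    (introT card_gt0P (ex_intro _ set0 PI)).
by exists I; split; rewrite // -eI.
Qed.

Lemma rank_indep I : I \in indep M -> rank M I = #|I|.
Proof.
move=> iI; apply/eqP; rewrite eqn_leq indep_rank // andbT.
by have [J [_ /subset_leq_card + <-]] := rank_indepE I.
Qed.

Lemma rank_le_card A : rank M A <= #|A|.
Proof. by have [J [_ /subset_leq_card + <-]] := rank_indepE A. Qed.

Lemma indep_rankE I : (I \in indep M) = (rank M I == #|I|).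
Proof.
apply/idP/eqP => [/rank_indep//|eI].
have [J [iJ sJI]] := rank_indepE I; rewrite eI => cJ.
suff <- : J = I by [].
by apply/eqP; rewrite eqEcard sJI cJ /=.
Qed.

Lemma rankS A B : A \subset B -> rank M A <= rank M B.
Proof.
move=> sAB; have [J [iJ sJA <-]] := rank_indepE A.
exact: indep_rank iJ (subset_trans sJA sAB).
Qed.

Lemma indep_extend I A : I \in indep M -> I \subset A ->
  exists J, [/\ J \in indep M, I \subset J, J \subset A & #|J| = rank M A].
Proof.
move=> iI sIA; pose P J := (J \in indep M) && (J \subset A).
have [J /maxsetP[/andP[iJ sJA] maxJ] sIJ] : {J | maxset P J & I \subset J}.
  by apply: maxset_exists; rewrite /P iI.
exists J; split => //; apply/eqP; rewrite eqn_leq indep_rank //= leqNgt.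
apply/negP => lt; have [K [iK sKA eK]] := rank_indepE A.
have [x /setDP[xK xJ] ix] := indep_aug iJ iK (leq_trans lt (eq_leq (esym eK))).
have Px : P (x |: J) by rewrite /P ix subUset sub1set (subsetP sKA) ?sJA.
by have := maxJ _ Px (subsetUr _ _); move/setP/(_ x); rewrite setU11 (negPf xJ).
Qed.

(** Extend a largest independent [I] inside [A :&: B] to a largest independent [J] inside [A :|: B].
    The traces of [J] on [A] and [B] have together at least [#|J| + #|I|] elements. *)
Lemma rank_submod A B :
  rank M (A :&: B) + rank M (A :|: B) <= rank M A + rank M B.
Proof.
have [I [iI sIAB eI]] := rank_indepE (A :&: B).
have [J [iJ sIJ sJAB <-]] := indep_extend iI (subset_trans sIAB
  (subset_trans (subsetIl _ _) (subsetUl A B))).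
have leA : #|J :&: A| <= rank M A.
  by rewrite indep_rank ?subsetIr // (indepS iJ (subsetIl _ _)).
have leB : #|J :&: B| <= rank M B.
  by rewrite indep_rank ?subsetIr // (indepS iJ (subsetIl _ _)).
apply: leq_trans (leq_add leA leB); rewrite -cardsUI -setIUr (setIidPl sJAB).
rewrite addnC leq_add2l -eI subset_leq_card // setIACA setIid subsetI sIJ.
by rewrite sIAB.
Qed.

Lemma rank1_loopless e : loopless M -> e \in ground M -> rank M [set e] = 1.
Proof.
move=> nl eE; rewrite rank_indep ?cards1 //; apply: contraT => ne.
case/negP: (nl e); apply/minsetP; rewrite sub1set eE ne; split=> // D.
case/andP=> _ nD; rewrite subset1 => /orP[/eqP//|/eqP D0].
by rewrite D0 indep0 in nD.
Qed.

Lemma rank_gt0 A : loopless M -> A \subset ground M -> A != set0 -> 0 < rank M A.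
Proof.
move=> nl sA /set0Pn[e eA]; rewrite -(@rank1_loopless e) ?(subsetP sA) //.
by rewrite rankS ?sub1set.
Qed.

Lemma rank2_simple e f : simple M -> e \in ground M -> f \in ground M ->
  e != f -> rank M [set e; f] = 2.
Proof.
move=> [nl np] eE fE ef; have c2 : #|[set e; f]| = 2 by rewrite cards2 ef.
rewrite rank_indep ?c2 //; apply: contraT => ne.
case/negP: (np e f); rewrite /parallel ef /=.
apply/minsetP; rewrite subUset !sub1set eE fE ne; split=> // D.
case/andP=> sD nD sDef; apply/eqP; rewrite eqEcard sDef c2 leqNgt.
apply/negP => cD; case/negP: nD; rewrite indep_rankE eqn_leq rank_le_card /=.
have [->|D0] := eqVneq D set0; first by rewrite cards0.
by rewrite -ltnS (leq_trans cD) // ltnS rank_gt0.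
Qed.

Lemma simple_card1 A : simple M -> A \subset ground M -> rank M A <= 1 -> #|A| <= 1.
Proof.
move=> sM sA rA; rewrite leqNgt; apply/negP => /card_gt1P[e [f [eA fA ef]]].
have := @rankS [set e; f] A; rewrite rank2_simple ?(subsetP sA) //.
by rewrite subUset !sub1set eA fA; lia.
Qed.

Lemma rank_restrict A B : rank (restrict M A) B = rank M (A :&: B).
Proof.
rewrite /rank; apply: eq_bigl => I /=.
by rewrite inE subsetI andbA.
Qed.

Lemma baseE B : base M B = (B \in indep M) && (#|B| == rk M).
Proof.
apply/idP/andP=> [bB|[iB /eqP cB]].
  have iB := base_indep bB; split=> //.
  have [I [iI _ eI]] := rank_indepE (ground M).
  by rewrite eqn_leq indep_rank ?indep_ground //= /rk -eI (indep_base_card iI bB).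
apply/maxsetP; split=> // D iD sBD; apply/esym/eqP.
by rewrite eqEcard sBD cB indep_rank ?indep_ground.
Qed.

Lemma dual_indepE I :
  (I \in indep (dual M)) = (I \subset ground M) && (rank M (ground M :\: I) == rk M).
Proof.
rewrite /= inE; apply/existsP/andP => [[B /andP[bB sI]]|[sI /eqP rI]].
  have sIE := subset_trans sI (subsetDl _ _); split=> //.
  rewrite baseE in bB; case/andP: bB => iB /eqP cB.
  rewrite eqn_leq rankS ?subsetDl //= -cB indep_rank //.
  rewrite subsetD indep_ground //= disjoint_sym.
  by move: sI; rewrite subsetD => /andP[].
have [B [iB sB cB]] := rank_indepE (ground M :\: I).
exists B; rewrite baseE iB cB rI eqxx /= subsetD sI disjoint_sym.
by move: sB; rewrite subsetD => /andP[].
Qed.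

(** A set whose removal lowers the rank is dependent in the dual, so it contains a cocircuit. *)
Lemma cogirth_le D : D \subset ground M ->
  rank M (ground M :\: D) < rk M -> cogirth M <= #|D|.
Proof.
move=> sD rD.
have [C /[dup] cC /minsetP[/andP[sC _] _] sCD] : {C | cocircuit M C & C \subset D}.
  by apply: minset_exists; rewrite sD dual_indepE sD neq_ltn rD.
apply: leq_trans (subset_leq_card sCD).
rewrite /cogirth; elim: index_enum (mem_index_enum C) => // C' s IHs.
rewrite inE big_cons => /orP[/eqP <-|/IHs le]; first by rewrite cC geq_minl.
by case: ifP => // _; apply: leq_trans (geq_minr _ _) le.
Qed.

Lemma cogirth_ex : 0 < rk M -> exists D,
  [/\ D \subset ground M, #|D| = cogirth M & rank M (ground M :\: D) < rk M].
Proof.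
move=> rM; rewrite /cogirth.
apply: (big_ind (fun n => exists D,
  [/\ D \subset ground M, #|D| = n & rank M (ground M :\: D) < rk M])).
(* The unit [#|ground M|] of the minimum is realised by the whole ground set, whose removal leaves
   rank 0. *)
- exists (ground M); rewrite setDv; split=> //.
  by apply: leq_ltn_trans rM; rewrite -(@cards0 T) rank_le_card.
- move=> m n Pm Pn; rewrite /minn; by case: ifP.
move=> C /minsetP[/andP[sC nC] _]; exists C; split=> //.
move: nC; rewrite dual_indepE sC /= neq_ltn => /orP[//|].
by rewrite ltnNge rankS ?subsetDl.
Qed.

End Rank.

Lemma simple_indep2 (T : finType) (M : matroid T) (I : {set T}) :
  simple M -> I \subset ground M -> #|I| <= 2 -> I \in indep M.
Proof.
move=> sM sI; rewrite leq_eqVlt => /orP[/cards2P[e [f [ef eI]]]|].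
  have eE : e \in ground M by rewrite (subsetP sI) // eI !inE eqxx.
  have fE : f \in ground M by rewrite (subsetP sI) // eI !inE eqxx orbT.
  by rewrite eI indep_rankE rank2_simple // cards2 ef.
have [->|nI] := eqVneq I set0; first by rewrite indep0.
rewrite ltnS => c1; rewrite indep_rankE eqn_leq rank_le_card.
exact: leq_trans c1 (rank_gt0 (proj1 sM) sI nI).
Qed.

Lemma subset_imset_ex (T T' : finType) (f : T -> T') (I : {set T'}) (A : {set T}) :
  I \subset f @: A -> exists2 B : {set T}, B \subset A & I = f @: B.
Proof.
move=> sI; exists (A :&: f @^-1: I); first exact: subsetIl.
apply/setP=> x; apply/idP/imsetP => [xI|[y + ->]]; last by rewrite !inE => /andP[].
have /imsetP[y yA exy] := subsetP sI x xI.
by exists y; rewrite // !inE yA -exy.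
Qed.

(** * The counting bound *)

Section Extremal.
Variables (T : finType) (M : matroid T) (k : nat).
Hypotheses (k_ge4 : 4 <= k) (simpleM : simple M) (degM : minimally_degenerate k M).
Implicit Types A B D H I L X Y : {set T}.

Local Notation E := (ground M).
Local Notation rho := (rank M).
Local Notation r := (rk M).

Let llM : loopless M := proj1 simpleM.

Lemma ground_neq0 : E != set0. Proof. by case: degM. Qed.

Lemma rk_gt0 : 0 < r.
Proof. by rewrite rank_gt0 // ground_neq0. Qed.

Lemma hyperplane_card H : H \subset E -> rho H < r -> #|H| + k <= #|E|.
Proof.
move=> sH rH; have [_ _ <- _] := degM.
have sEH : E :\: H \subset E by apply: subsetDl.
have EH : E :\: (E :\: H) = H by rewrite setDDr setDv set0U (setIidPr sH).
have := cogirth_le sEH; rewrite EH => /(_ rH).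
by have := cardsID H E; rewrite (setIidPr sH); lia.
Qed.

Lemma hyperplane_ex : exists H, [/\ H \subset E, rho H < r & #|E| = #|H| + k].
Proof.
have [D [sD cD rD]] := cogirth_ex rk_gt0.
exists (E :\: D); split; rewrite ?subsetDl //.
have [_ _ ck _] := degM; have := cardsID D E.
by rewrite (setIidPr sD) cD ck; lia.
Qed.

(** [B] is what remains of [A] after deleting a smallest cocircuit of the restriction to [A]; it may
    be empty. *)
Lemma proper_drop A : A \proper E -> A != set0 ->
  exists B, [/\ B \subset A, rho B < rho A & #|A| <= #|B| + k.-1].
Proof.
move=> pA nA; have sA := proper_sub pA; have [_ _ _ degA] := degM.
have EA : E :&: A = A by apply/setIidPr.
have rA : rk (restrict M A) = rho A by rewrite /rk rank_restrict /= EA setIid.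
have gA : ground (restrict M A) = A by rewrite /= EA.
have r0 : 0 < rk (restrict M A) by rewrite rA rank_gt0.
have [D [sD cD]] := cogirth_ex r0; rewrite rA rank_restrict gA => rD.
exists (A :\: D); split; first exact: subsetDl.
  by rewrite (setIidPr (subsetDl _ _)) in rD.
rewrite gA in sD; have := cardsID D A; rewrite (setIidPr sD) cD.
by have := degA A pA nA; lia.
Qed.

(** Iterate [proper_drop] down to rank 1, where simplicity leaves one element. The additive form
    avoids truncated subtraction. *)
Lemma proper_count A : A \proper E -> A != set0 -> #|A| + k.-1 <= k.-1 * rho A + 1.
Proof.
have [n] := ubnP #|A|; elim: n A => // n IHn A ltAn pA nA.
have [B [sB rB cB]] := proper_drop pA nA.
have rA : 0 < rho A by rewrite rank_gt0 // proper_sub.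
have [r1|rA2] := leqP (rho A) 1.
  by have := simple_card1 simpleM (proper_sub pA) r1; nia.
(* If nothing remains, [A] has at most k - 1 elements, and the bound holds because its rank is at
   least 2. *)
have [B0|nB] := eqVneq B set0.
  by move: cB; rewrite B0 cards0; nia.
have := IHn B; have pB : B \proper E by apply: sub_proper_trans pA.
have : #|B| < #|A|.
  apply: proper_card; rewrite properE sB; apply/negP => /(rankS M); lia.
by move=> lt /(_ (leq_trans lt ltAn) pB nB); nia.
Qed.

(** The first deletion costs k instead of k - 1, which turns the constant 1 of [proper_count] into
    2. *)
Lemma ground_count : 2 <= r /\ #|E| + k.-1 <= k.-1 * r + 2.
Proof.
have [H [sH rH cE]] := hyperplane_ex.
have r2 : 2 <= r.
  rewrite ltnNge; apply/negP => r1.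
  by have := simple_card1 simpleM (subxx E) r1; lia.
split=> //; have [H0|nH] := eqVneq H set0; first by move: cE; rewrite H0 cards0; nia.
have pH : H \proper E.
  by rewrite properE sH; apply/negP => /(rankS M); rewrite -/(rk M); lia.
by have := proper_count pH nH; nia.
Qed.

(** * Tight sets, when the bound is attained *)

Hypothesis cardE : #|E| + k.-1 = k.-1 * r + 2.

Definition tight X := [&& X != set0, X \proper E & #|X| + k.-1 == k.-1 * rho X + 1].

Lemma tightP X : reflect [/\ X != set0, X \proper E & #|X| + k.-1 = k.-1 * rho X + 1]
  (tight X).
Proof.
by apply: (iffP and3P) => -[? ? ?]; split=> //; apply/eqP.
Qed.

Lemma tight_sub X : tight X -> X \subset E.
Proof. by case/tightP => _ /proper_sub. Qed.

(** By [proper_count], no proper subset of [E] of at most this rank has more elements than a tight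
    set. *)
Lemma tight_max X Y : tight X -> X \subset Y -> Y \proper E -> rho Y <= rho X -> Y = X.
Proof.
case/tightP=> nX pX cX sXY pY rY; apply/esym/eqP; rewrite eqEcard sXY /=.
have nY : Y != set0 by apply: contraNneq nX => Y0; rewrite -subset0 -Y0.
by have := proper_count pY nY; nia.
Qed.

(** Cardinality is modular and rank submodular, so the upper bounds of [proper_count] for the
    intersection and the union must both be equalities. *)
Lemma tightUI X Y : tight X -> tight Y -> X :&: Y != set0 -> X :|: Y != E ->
  tight (X :&: Y) && tight (X :|: Y).
Proof.
move=> tX tY nXY nE; have [nX pX cX] := tightP _ tX; have [nY pY cY] := tightP _ tY.
have pI : X :&: Y \proper E by apply: sub_proper_trans (subsetIl _ _) pX.
have pU : X :|: Y \proper E by rewrite properEneq nE subUset !proper_sub.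
have nU : X :|: Y != set0 by rewrite setU_eq0 (negPf nX).
have cI := proper_count pI nXY; have cU := proper_count pU nU.
have := leq_mul (leqnn k.-1) (rank_submod M X Y); rewrite !mulnDr => submod.
have cUI := cardsUI X Y.
have arith (i u x y a b c d q : nat) : i + q <= a + 1 -> u + q <= b + 1 ->
    x + q = c + 1 -> y + q = d + 1 -> u + i = x + y -> a + b <= c + d ->
    i + q = a + 1 /\ u + q = b + 1 by clear; lia.
have [eI eU] := arith _ _ _ _ _ _ _ _ _ cI cU cX cY cUI submod.
by rewrite /tight nXY pI pU nU eI eU !eqxx.
Qed.

(** A rank drop would make the complement [[set e]] have at least k elements. *)
Lemma tightD1 e : e \in E -> tight (E :\ e) /\ rho (E :\ e) = r.
Proof.
move=> eE; have [r2 _] := ground_count.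
have c1 : #|E| = #|E :\ e|.+1 by rewrite (cardsD1 e) eE.
have rE : rho (E :\ e) = r.
  apply/eqP; rewrite eqn_leq rankS ?subsetDl //= leqNgt; apply/negP => lt.
  by have := hyperplane_card (subsetDl _ _) lt; move: c1 k_ge4; clear; lia.
split=> //; apply/tightP; rewrite rE properD1 //; split=> //; last first.
  by move: cardE c1; clear; lia.
by rewrite -card_gt0; move: cardE c1 r2 k_ge4; clear; nia.
Qed.

(** The set given by [proper_drop] loses at most k - 1 elements, while by [proper_count] a loss of
    two ranks would cost at least 2(k - 1). Hence the rank drops by one and equality holds
    throughout. *)
Lemma tight_step X : tight X -> 2 <= rho X -> exists X',
  [/\ tight X', X' \subset X, rho X' = (rho X).-1 & #|X| = #|X'| + k.-1].
Proof.
case/tightP=> nX pX cX r2; have [B [sB rB cB]] := proper_drop pX nX.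
have [m rX] : exists m, rho X = m.+2 by exists (rho X - 2); move: r2; clear; lia.
rewrite rX in cX rB *; rewrite !mulnS in cX; have := leq0n (k.-1 * m) => m0.
have nB : B != set0 by rewrite -card_gt0; move: cX cB m0; clear; lia.
have pB : B \proper E by apply: sub_proper_trans pX.
have cB' := proper_count pB nB.
have rB' : rho B = m.+1.
  apply/eqP; rewrite eqn_leq -ltnS rB leqNgt; apply/negP => lt.
  have : k.-1 * rho B <= k.-1 * m by rewrite leq_mul2l -ltnS lt orbT.
  by move: cX cB cB' k_ge4; clear; lia.
rewrite rB' mulnS in cB'; exists B; split=> //; last by move: cX cB cB'; clear; lia.
by apply/tightP; split=> //; rewrite rB' mulnS; move: cX cB cB'; clear; lia.
Qed.

(** * Tight lines and tight hyperplanes *)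

Definition tight_line L := tight L && (rho L == 2).

Lemma tight_line_card L : tight_line L -> #|L| = k.
Proof.
case/andP=> /tightP[_ _ cL] /eqP rL.
by move: cL k_ge4; rewrite rL; clear; lia.
Qed.

Lemma tight_line_ex X : tight X -> 2 <= rho X -> exists2 L, tight_line L & L \subset X.
Proof.
have [n] := ubnP (rho X); elim: n X => // n IHn X ltn tX r2.
have [X' [tX' sX' rX' _]] := tight_step tX r2.
have [r2e|r3] := leqP (rho X) 2.
  by exists X; rewrite // /tight_line tX eqn_leq r2 r2e.
have [||L tL sL] := IHn X' _ tX'.
- by move: rX' r2 ltn; clear; lia.
- by rewrite rX' -ltnS prednK // ltnW.
exists L => //.
exact: subset_trans sX'.
Qed.

(** Apply [tight_step] to [E :\ e]: the k missing elements are [e] and the k - 1 lost in the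
    step. *)
Lemma tight_hyperplane_avoiding e : e \in E ->
  exists H, [/\ tight H, e \notin H, rho H = r.-1 & #|E| = #|H| + k].
Proof.
move=> eE; have [r2 _] := ground_count; have [tE rE] := tightD1 eE.
have [|H [tH sH rH cH]] := tight_step tE; first by rewrite rE.
exists H; split; rewrite ?rH ?rE //; last first.
  by rewrite (cardsD1 e) eE cH; move: k_ge4; clear; lia.
by apply/negP => /(subsetP sH); rewrite !inE eqxx.
Qed.

(** By simplicity two points of [L] already have rank 2, so adding [L] to [X] does not raise the
    rank, and [tight_max] applies. *)
Lemma tight_line_sub L X : tight_line L -> tight X -> L :|: X != E ->
  1 < #|X :&: L| -> L \subset X.
Proof.
move=> /andP[tL /eqP rL] tX nE cI.
have pU : X :|: L \proper E by rewrite properEneq setUC nE subUset !tight_sub.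
rewrite -(@tight_max X (X :|: L)) ?subsetUr ?subsetUl //.
have rI : 2 <= rho (X :&: L).
  rewrite ltnNge; apply/negP => r1.
  have sI : X :&: L \subset E := subset_trans (subsetIl _ _) (tight_sub tX).
  by have := simple_card1 simpleM sI r1; move: cI; clear; lia.
by have := rank_submod M X L; move: rI rL; clear; lia.
Qed.

(** * Rank at least 3: the ground set splits into two tight lines *)

Hypothesis r_ge3 : 3 <= r.

Lemma tight_line_compl L : tight_line L -> tight (E :\: L) /\ rho (E :\: L) = r.-1.
Proof.
move=> tL; have cL := tight_line_card tL; have /andP[tightL /eqP rL] := tL.
have sL := tight_sub tightL.
(* A tight hyperplane disjoint from [L] is its complement, since it misses exactly k = |L|
   elements. *)
suff [e [eL [H [tH eH rH cH] LH]]] : exists e, e \in L /\ exists2 H,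
    [/\ tight H, e \notin H, rho H = r.-1 & #|E| = #|H| + k] & H :&: L = set0.
  suff -> : E :\: L = H by [].
  apply/esym/eqP; rewrite eqEcard subsetD tight_sub // -setI_eq0 LH eqxx /=.
  by have := cardsID L E; rewrite (setIidPr sL); move: cL cH; clear; lia.
have [e eL] : exists e, e \in L.
  by apply/set0Pn; rewrite -card_gt0 cL; move: k_ge4; clear; lia.
have meet1 f : f \in L -> exists H,
    [/\ tight H, f \notin H, rho H = r.-1, #|E| = #|H| + k & #|H :&: L| <= 1].
  move=> fL; have [H [tH fH rH cH]] := tight_hyperplane_avoiding (subsetP sL _ fL).
  exists H; split=> //; rewrite leqNgt; apply/negP => c2.
  (* If [L] and [H] cover [E], submodularity leaves [H :&: L] rank at most 1, against its two
     points. Otherwise [L] lies in [H], against the choice of [f]. *)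
  have [LH|nLH] := eqVneq (L :|: H) E.
    have rI : 2 <= rho (H :&: L).
      rewrite ltnNge; apply/negP => r1.
      have sI : H :&: L \subset E := subset_trans (subsetIl _ _) (tight_sub tH).
      by have := simple_card1 simpleM sI r1; move: c2; clear; lia.
    have := rank_submod M H L; rewrite setUC LH -/(rk M).
    by move: rI rL rH r_ge3; clear; lia.
  by case/negP: fH; apply: subsetP fL; apply: tight_line_sub.
(* If neither [H] nor [H'] below is disjoint from [L], then [H :|: H'] misses at
   least k - 2 >= 2 elements of [L], while a tight set of rank r misses one. *)
have [H [tH eH rH cH le1]] := meet1 e eL.
have [H0|/set0Pn[f]] := eqVneq (H :&: L) set0; first by exists e; split=> //; exists H.
rewrite inE => /andP[fH fL].
have [H' [tH' fH' rH' cH' le1']] := meet1 f fL.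
have [H0|nL] := eqVneq (H' :&: L) set0; first by exists f; split=> //; exists H'.
have cLHH : 2 <= #|L :\: (H :|: H')|.
  have := cardsID (H :|: H') L; rewrite cL setIUr ![L :&: _]setIC.
  by have := (leq_card_setU (H :&: L) (H' :&: L)).1; move: le1 le1' k_ge4; clear; lia.
have sLE : L :\: (H :|: H') \subset E :\: (H :|: H') by apply: setSD.
have sUE : H :|: H' \subset E by rewrite subUset !tight_sub.
have cU : #|H :|: H'| + 2 <= #|E|.
  have := cardsID (H :|: H') E; rewrite (setIidPr sUE).
  by have := subset_leq_card sLE; move: cLHH; clear; lia.
have nU : H :|: H' != E by apply: contraTneq cU => ->; clear; lia.
have pU : H :|: H' \proper E by rewrite properEneq nU.
(* Otherwise [tight_max] makes both hyperplanes equal to their union, but [f] lies only in [H]. *)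
have rU : rho (H :|: H') = r.
  apply/eqP; rewrite eqn_leq rankS //= leqNgt; apply/negP => lt.
  have HH : H :|: H' = H.
    by apply: tight_max; rewrite ?subsetUl // rH -ltnS prednK // rk_gt0.
  have HH' : H :|: H' = H'.
    by apply: tight_max; rewrite ?subsetUr // rH' -ltnS prednK // rk_gt0.
  by case/negP: fH'; rewrite -HH' HH.
(* Disjointness would give |E| <= 2k - 2 by [cU], whereas |H| >= k in rank at least 3 gives |E| >=
   2k. *)
have [HH0|HH] := eqVneq (H :&: H') set0.
  have := cardsUI H H'; rewrite HH0 cards0.
  have /tightP[_ _] := tH; rewrite rH; move: cU cH cH' r_ge3 k_ge4.
  by clear; nia.
have /andP[_ /tightP[_ _]] := tightUI tH tH' HH nU.
by rewrite rU; move: cardE cU; clear; lia.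
Qed.

(** If [X'] has two points of [L], [tight_line_sub] applies. Otherwise the k - 1 elements of
    [X :\: X'] are all on [L], and the union of [X'] with the hyperplane [E :\: L] would be a tight
    set of impossible size. *)
Lemma tight_line_step X X' L : tight X -> 3 <= rho X -> tight X' -> X' \subset X ->
  rho X' = (rho X).-1 -> #|X| = #|X'| + k.-1 -> tight_line L -> L \subset X ->
  L \subset X'.
Proof.
move=> tX rX tX' sX' rX' cX tL sL; have cL := tight_line_card tL.
have /andP[tightL /eqP rL] := tL.
have [tH rH] := tight_line_compl tL; set H := E :\: L in tH rH.
have pX : X \proper E by case/tightP: tX.
have [le1|gt1] := leqP #|X' :&: L| 1; last first.
  apply: tight_line_sub => //; apply: contraTneq pX => LX.
  by rewrite properE negb_and negbK -LX subUset sL sX' orbT.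
have sLX : L :\: X' \subset X :\: X' by apply: setSD.
have c1 : #|X :\: X'| = k.-1.
  by have := cardsID X' X; rewrite (setIidPr sX'); move: cX; clear; lia.
have c2 : #|L :\: X'| = k.-1.
  have := subset_leq_card sLX; have := cardsID X' L; rewrite setIC.
  by move: c1 le1 cL; clear; lia.
(* Otherwise [X'] lies in [L] and has at most one element, although its rank is at least 2. *)
have nI : X' :&: H != set0.
  apply/eqP => I0; have : X' \subset L.
    have : X' :&: E = X' by apply/setIidPl/tight_sub.
    by move=> <-; rewrite -(setID E L) setIUr -/H I0 setU0 !subIset ?subxx ?orbT.
  move/setIidPl=> XL; rewrite XL in le1.
  have /tightP[_ _] := tX'; rewrite rX'; move: le1 rX k_ge4; clear; nia.
(* [X' :|: H] has |E| - (k - 1) elements, which is not 1 modulo k - 1, so it is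
   not tight. *)
have UE : X' :|: H = E :\: (L :\: X').
  apply/setP=> x; rewrite !inE; have := subsetP (tight_sub tX') x.
  by case: (x \in X'); case: (x \in E); case: (x \in L) => // /(_ isT).
have cU : #|E| = #|X' :|: H| + k.-1.
  rewrite UE; have := cardsID (L :\: X') E.
  by rewrite (setIidPr (subset_trans (subsetDl _ _) (tight_sub tightL))) c2; clear; lia.
have nU : X' :|: H != E.
  by apply: contraTneq k_ge4 => UE'; rewrite UE' in cU; move: cU; clear; lia.
have /andP[_ /tightP[_ _]] := tightUI tX' tH nI nU.
have := rankS M (subsetUr X' H); rewrite rH.
have sU : X' :|: H \subset E by rewrite subUset !tight_sub.
have := rankS M sU; rewrite -/(rk M); move: cardE cU r_ge3 k_ge4.
case: (rk M) => // m; move: (rho _) => p cE cU' _ k4 lepm lemp cX'U.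
have [pm|pm] : p = m.+1 \/ p = m by move: lepm lemp; clear; lia.
  by move: cE cX'U cU' k4; rewrite pm !mulnS; clear; lia.
by move: cE cX'U cU' k4; rewrite pm !mulnS; clear; lia.
Qed.

(** [tight_line_step] pushes both lines into a tight set of smaller rank; in rank 2 both equal [X]
    by [tight_max]. *)
Lemma tight_line_uniq X L L' : tight X -> tight_line L -> tight_line L' ->
  L \subset X -> L' \subset X -> L = L'.
Proof.
have [n] := ubnP (rho X); elim: n X => // n IHn X ltn tX tL tL' sL sL'.
have [/andP[_ /eqP rL] /andP[_ /eqP rL']] := (tL, tL').
have r2 : 2 <= rho X by rewrite -rL rankS.
have [r2'|r3] := leqP (rho X) 2.
  have pX : X \proper E by case/tightP: tX.
  have /andP[tightL _] := tL; have /andP[tightL' _] := tL'.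
  by rewrite -(tight_max tightL sL) ?rL // -(tight_max tightL' sL') ?rL'.
have [X' [tX' sX' rX' cX]] := tight_step tX r2.
apply: (IHn X'); rewrite ?(tight_line_step tX _ tX' sX' rX' cX) //.
by move: rX' r3 ltn; clear; lia.
Qed.

Lemma ground_two_lines : exists L L',
  [/\ tight_line L, tight_line L', [disjoint L & L'] & E = L :|: L'].
Proof.
have [e eE] := set0Pn _ ground_neq0.
have [tE rE] := tightD1 eE.
have [|L tL _] := tight_line_ex tE; first by rewrite rE ltnW.
have [tH rH] := tight_line_compl tL.
have [|L' tL' sL'] := tight_line_ex tH; first by rewrite rH -ltnS prednK ?rk_gt0.
have cL := tight_line_card tL.
have /andP[tightL _] := tL; have /andP[tightL' _] := tL'.
have dL : [disjoint L & L'].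
  by move: sL'; rewrite subsetD disjoint_sym => /andP[].
exists L, L'; split=> //; apply/eqP; rewrite eqEsubset subUset.
rewrite (tight_sub tightL) (tight_sub tightL') /= andbT.
apply/subsetP => f fE; apply: contraT; rewrite inE negb_or => /andP[fL fL'].
have [tF _] := tightD1 fE.
have LL : L = L' by apply: (tight_line_uniq tF); rewrite // subsetD1 tight_sub ?fL.
by move: dL; rewrite -LL -setI_eq0 setIid -cards_eq0 cL; move: k_ge4; clear; lia.
Qed.

(** The point of [I] on [L'] raises the rank of [L] to 3, as [L] is maximal of rank 2. Since
    [I :&: L] already has the rank of [L], submodularity gives [I] rank 3. *)
Lemma tight_line_plane L L' I : tight_line L -> tight_line L' -> [disjoint L & L'] ->
  E = L :|: L' -> I \subset E -> #|I :&: L| = 2 -> #|I :&: L'| = 1 -> I \in indep M.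
Proof.
move=> tL tL' dL EL sI c2 c1; have /andP[tightL /eqP rL] := tL.
have cI : #|I| = 3.
  rewrite -(setIidPl sI) EL setIUr; have := cardsUI (I :&: L) (I :&: L').
  by rewrite setIACA (disjoint_setI0 dL) setI0 cards0 c1 c2 addn0.
rewrite indep_rankE eqn_leq rank_le_card cI.
have r2 : rho (I :&: L) = 2.
  apply/eqP; rewrite -c2 -indep_rankE simple_indep2 ?c2 //.
  exact: subset_trans (subsetIl _ _) sI.
have [x] : exists x, x \in I :&: L' by apply/set0Pn; rewrite -card_gt0 c1.
rewrite inE => /andP[xI xL'].
have xL : x \notin L by rewrite (disjointFl dL).
suff rIL : 3 <= rho (I :|: L).
  by have := rank_submod M I L; move: rL rIL r2; clear; lia.
have sxL : x |: L \subset I :|: L by rewrite setSU // sub1set.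
apply: leq_trans (rankS M sxL); rewrite ltnNge; apply/negP => le2.
have : x |: L = L.
  apply: tight_max; rewrite ?subsetUr ?rL // properEcard subUset sub1set.
  rewrite (subsetP sI) // tight_sub // cardsU1 xL EL cardsU (disjoint_setI0 dL) cards0.
  by rewrite !tight_line_card // subn0; move: k_ge4; clear; lia.
by move/setP/(_ x); rewrite !inE eqxx (negPf xL).
Qed.

Lemma two_lines_indepE L L' I : tight_line L -> tight_line L' -> [disjoint L & L'] ->
  E = L :|: L' -> r = 3 -> I \subset E ->
  (I \in indep M) = [&& #|I :&: L| <= 2, #|I :&: L'| <= 2 & #|I| <= 3].
Proof.
move=> tL tL' dL EL r3 sI; apply/idP/and3P=> [iI|[le1 le2 le3]].
  have le A : #|I :&: A| <= rho A.
    by rewrite indep_rank ?subsetIr // (indepS iI) ?subsetIl.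
  have [/andP[_ /eqP rL] /andP[_ /eqP rL']] := (tL, tL').
  by rewrite -[in #|I| <= _]r3 indep_rank // -{1}rL -rL' !le.
have [|c2] := leqP #|I| 2; first exact: simple_indep2.
have cI : #|I| = #|I :&: L| + #|I :&: L'|.
  rewrite -{1}(setIidPl sI) EL setIUr; have := cardsUI (I :&: L) (I :&: L').
  by rewrite setIACA (disjoint_setI0 dL) setI0 cards0 addn0.
(* Simplicity settles sets of at most two elements; three elements can only split as 2 + 1. *)
have [[e1 e2]|[e1 e2]] : (#|I :&: L| = 2 /\ #|I :&: L'| = 1) \/
    (#|I :&: L'| = 2 /\ #|I :&: L| = 1) by move: cI le1 le2 le3 c2; clear; lia.
  exact: (tight_line_plane tL tL').
by apply: (tight_line_plane tL' tL); rewrite // ?[L' :|: L]setUC // disjoint_sym.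
Qed.

End Extremal.

(** * Circuits, isomorphisms and uniform matroids *)

Lemma card_sub_ex (T : finType) (A : {set T}) n : n <= #|A| ->
  exists2 B : {set T}, B \subset A & #|B| = n.
Proof.
case/card_geqP=> s [us ss sA]; exists [set:: s].
  by apply/subsetP => x; rewrite inE => /sA.
by rewrite cardsE (card_uniqP us).
Qed.

Lemma circuit_sub_ex (T : finType) (M : matroid T) (A : {set T}) :
  A \subset ground M -> A \notin indep M -> exists2 C, circuit M C & C \subset A.
Proof.
move=> sA nA; have [|C cC sC] := @minset_exists _
  (fun D => (D \subset ground M) && (D \notin indep M)) A; first by rewrite sA.
by exists C.
Qed.

Lemma circuit_dep (T : finType) (M : matroid T) (C : {set T}) :
  circuit M C -> C \subset ground M /\ C \notin indep M.
Proof. by case/minsetP => /andP[]. Qed.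

Lemma isomorphic_rk (T T' : finType) (M : matroid T) (N : matroid T') :
  isomorphic M N -> #|ground M| = #|ground N| /\ rk M = rk N.
Proof.
case=> f [injf fE indf]; split; first by rewrite -fE card_in_imset.
apply/eqP; rewrite eqn_leq /rk; apply/andP; split.
  have [I [iI sI <-]] := rank_indepE M (ground M).
  have inj : {in I &, injective f}.
    by move=> x y /(subsetP sI) ? /(subsetP sI); apply: injf.
  by rewrite -(card_in_imset inj) indep_rank ?indf // -fE imsetS.
have [J [iJ sJ <-]] := rank_indepE N (ground N).
move: iJ sJ; rewrite -fE => iJ /subset_imset_ex[I sI eJ].
by rewrite eJ (leq_trans (leq_imset_card _ _)) // indep_rank // -indf // -eJ.
Qed.

(** An isomorphism is a total map on [T]; the size [n.+1] makes the ordinal type inhabited, so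
    [inord] can supply it. *)
Lemma isomorphic_uniformP (T : finType) (M : matroid T) m n :
  isomorphic M (uniform m n.+1) <->
  #|ground M| = n.+1 /\ forall A : {set T}, A \subset ground M ->
    (A \in indep M) = (#|A| <= m).
Proof.
split=> [isoM|[cM indM]].
  have [cM _] := isomorphic_rk isoM; split; first by rewrite cM /= cardsT card_ord.
  case: isoM => f [injf _ indf] A sA; rewrite -indf //= inE card_in_imset //.
  by move=> x y /(subsetP sA) ? /(subsetP sA); apply: injf.
pose f x : 'I_n.+1 := inord (index x (enum (ground M))); exists f.
have injf : {in ground M &, injective f}.
  move=> x y xE yE exy; have := congr1 (@nat_of_ord _) exy.
  rewrite /f !inordK -?cM ?cardE ?index_mem ?mem_enum // => {}exy.
  rewrite -(nth_index x (s := enum (ground M)) (x := x)) ?mem_enum // exy.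
  by rewrite nth_index ?mem_enum.
split=> //.
  apply/eqP; rewrite eqEcard subsetT /= card_in_imset // cM cardsT card_ord //.
move=> A sA; rewrite indM //= inE card_in_imset //.
by move=> x y /(subsetP sA) ? /(subsetP sA); apply: injf.
Qed.

(** * Copies of matroids on prescribed ground sets *)

Section UniformOn.
Variables (T : finType) (m : nat) (A : {set T}).

Let aindep : {set {set T}} := [set I : {set T} | (I \subset A) && (#|I| <= m)].

Let aindep_ground (I : {set T}) : I \in aindep -> I \subset A.
Proof. by rewrite inE => /andP[]. Qed.

Let aindep0 : set0 \in aindep.
Proof. by rewrite inE sub0set cards0. Qed.

Let aindepS (I J : {set T}) : J \in aindep -> I \subset J -> I \in aindep.
Proof.
rewrite !inE => /andP[sJ cJ] sIJ.
by rewrite (subset_trans sIJ) // (leq_trans _ cJ) // subset_leq_card.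
Qed.

Let aindep_aug (I J : {set T}) : I \in aindep -> J \in aindep -> #|I| < #|J| ->
  exists2 x, x \in J :\: I & x |: I \in aindep.
Proof.
rewrite !inE => /andP[sI _] /andP[sJ cJ] ltIJ.
have /subsetPn[x xJ xI] : ~~ (J \subset I).
  by apply/negP => /subset_leq_card; rewrite leqNgt ltIJ.
exists x; first by rewrite inE xI.
by rewrite inE subUset sub1set (subsetP sJ) // sI cardsU1 xI (leq_trans ltIJ).
Qed.

(** Unlike [uniform], this allows two uniform matroids to share a point of one type. *)
Definition uniform_on : matroid T :=
  Matroid aindep_ground aindep0 aindepS aindep_aug.

End UniformOn.

Section Lift.
Variables (T : finType) (M : matroid T).

Let injS : injective (@Some T). Proof. by move=> x y []. Qed.

Let lindep : {set {set option T}} := [set Some @: (I : {set T}) | I in indep M].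

Let lindepE (I : {set T}) : (Some @: I \in lindep) = (I \in indep M).
Proof.
apply/imsetP/idP => [[J iJ /(imset_inj injS) ->] //|iI].
by exists I.
Qed.

Let lindep_ground (I : {set option T}) : I \in lindep -> I \subset Some @: ground M.
Proof. by case/imsetP=> I0 /indep_ground sI ->; apply: imsetS. Qed.

Let lindep0 : set0 \in lindep.
Proof. by rewrite -(imset0 Some) lindepE indep0. Qed.

Let lindepS (I J : {set option T}) : J \in lindep -> I \subset J -> I \in lindep.
Proof.
case/imsetP=> J0 iJ -> /subset_imset_ex[I0 sI ->].
by rewrite lindepE (indepS iJ).
Qed.

Let lindep_aug (I J : {set option T}) : I \in lindep -> J \in lindep -> #|I| < #|J| ->
  exists2 x, x \in J :\: I & x |: I \in lindep.
Proof.
case/imsetP=> I0 iI -> /imsetP[J0 iJ ->]; rewrite !card_imset; try exact: injS.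
move=> ltIJ; have [x /setDP[xJ xI] ix] := indep_aug iI iJ ltIJ.
exists (Some x); first by rewrite inE !(mem_imset _ _ injS) xI.
by rewrite -imset_set1 -imsetU lindepE.
Qed.

(** Moving to [option T] frees the element [None] to be the basepoint of a 2-sum. *)
Definition lift_matroid : matroid (option T) :=
  Matroid lindep_ground lindep0 lindepS lindep_aug.

Lemma lift_indepE (I : {set T}) : (Some @: I \in indep lift_matroid) = (I \in indep M).
Proof. exact: lindepE. Qed.

Lemma isomorphic_lift : isomorphic M lift_matroid.
Proof. by exists Some; split=> [x y _ _ [] | | A _]; rewrite ?lift_indepE. Qed.

End Lift.

(** * 2-sums of two uniform matroids of rank 2 *)

Section TwoSumLines.
Variables (T : finType) (M1 M2 N : matroid T) (p : T).
Implicit Types C D I J : {set T}.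

Local Notation U2 M := (forall A : {set T}, A \subset ground M ->
  (A \in indep M) = (#|A| <= 2)).

Hypotheses (indM1 : U2 M1) (indM2 : U2 M2).
Hypothesis meetp : ground M1 :&: ground M2 = [set p].
Hypothesis groundN : ground N = (ground M1 :|: ground M2) :\ p.

Lemma U2_circuitE (M : matroid T) C :
  U2 M -> circuit M C = (C \subset ground M) && (#|C| == 3).
Proof.
move=> indM; apply/idP/andP.
  move=> /[dup]/circuit_dep[sC nC] /minsetP[_ minC].
  split=> //; move: nC; rewrite indM // -ltnNge => /card_sub_ex[D sD cD].
  rewrite -cD (minC D) ?cD ?eqxx // (subset_trans sD sC) indM ?cD //.
  exact: subset_trans sC.
case=> sC /eqP cC; apply/minsetP; rewrite sC indM // cC; split=> // D /andP[sD nD] sDC.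
apply/eqP; rewrite eqEcard sDC cC; move: nD; rewrite indM // -ltnNge //.
Qed.

Lemma U2_rk (M : matroid T) : U2 M -> 2 <= #|ground M| -> rk M = 2.
Proof.
move=> indM /card_sub_ex[D sD cD]; apply/eqP; rewrite eqn_leq /rk; apply/andP; split.
  by have [I [iI sI <-]] := rank_indepE M (ground M); rewrite -indM.
by rewrite -cD indep_rank // indM ?cD.
Qed.

Lemma U2_loop_coloop (M : matroid T) e : U2 M -> 3 <= #|ground M| -> e \in ground M ->
  ~~ loop M e /\ ~~ coloop M e.
Proof.
move=> indM cM eM; split.
  by apply/negP => /circuit_dep[sE]; rewrite indM // cards1.
apply/negP => /circuit_dep[_]; rewrite dual_indepE sub1set eM /= => /eqP; apply.
(* Two elements other than [e] form a base avoiding [e]. *)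
have [|D sD cD] := @card_sub_ex _ (ground M :\ e) 2.
  by move: cM; rewrite (cardsD1 e) eM.
apply/eqP; rewrite eqn_leq rankS ?subsetDl //= U2_rk ?(ltnW cM) //.
by rewrite -cD indep_rank // indM ?cD // (subset_trans sD) ?subsetDl.
Qed.

Let pM1 : p \in ground M1.
Proof. by have := set11 p; rewrite -meetp inE => /andP[]. Qed.

Let pM2 : p \in ground M2.
Proof. by have := set11 p; rewrite -meetp inE => /andP[]. Qed.

Let pN : p \notin ground N. Proof. by rewrite groundN !inE eqxx. Qed.

Let ground_meet0 : ground M1 :&: ground M2 :&: ground N = set0.
Proof. by rewrite meetp; apply/eqP; rewrite setI_eq0 disjoints1. Qed.

Let card_parts D : D \subset ground N -> #|D| = #|D :&: ground M1| + #|D :&: ground M2|.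
Proof.
move=> sD; rewrite -cardsUI -setIUr setIACA setIid.
have -> : D :&: (ground M1 :&: ground M2) = set0.
  by apply/eqP; rewrite setIC -subset0 -ground_meet0 setIS.
rewrite cards0 addn0 (setIidPl _) //; apply: subset_trans sD _.
by rewrite groundN subsetDl.
Qed.

(** Both circuits have three elements and they meet only in [p]. *)
Let circuit_parts C1 C2 : circuit M1 C1 -> p \in C1 -> circuit M2 C2 -> p \in C2 ->
  let C := (C1 :|: C2) :\ p in
  [/\ C \subset ground N, #|C :&: ground M1| = 2 & #|C :&: ground M2| = 2].
Proof.
rewrite !U2_circuitE // => /andP[s1 /eqP c1] p1 /andP[s2 /eqP c2] p2 C.
have inmeet x : x \in ground M1 -> x \in ground M2 -> x = p.
  by move=> x1 x2; apply/set1P; rewrite -meetp inE x1.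
have e1 : C :&: ground M1 = C1 :\ p.
  apply/setP => x; rewrite !inE; have [//|xp] := eqVneq x p.
  have [x1|x1] /= := boolP (x \in C1); first by rewrite (subsetP s1).
  apply/andP => -[/(subsetP s2) x2 x3].
  by rewrite (inmeet x) ?eqxx in xp.
have e2 : C :&: ground M2 = C2 :\ p.
  apply/setP => x; rewrite !inE; have [//|xp] := eqVneq x p.
  have [x1|x1] /= := boolP (x \in C2); first by rewrite orbT (subsetP s2).
  rewrite orbF; apply/andP => -[/(subsetP s1) x2 x3].
  by rewrite (inmeet x) ?eqxx in xp.
split; first by rewrite groundN setSD ?setUSS.
  by apply/eqP; rewrite e1 -(eqn_add2l (p \in C1)) -cardsD1 p1 c1.
by apply/eqP; rewrite e2 -(eqn_add2l (p \in C2)) -cardsD1 p2 c2.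
Qed.

(** The minimal sets violating the three inequalities are three points of one line, or two points of
    each line; the latter arise from two circuits through [p]. *)
Lemma lines_two_sum :
  (forall I, I \subset ground N -> (I \in indep N) =
    [&& #|I :&: ground M1| <= 2, #|I :&: ground M2| <= 2 & #|I| <= 3]) ->
  3 <= #|ground M1| -> 3 <= #|ground M2| -> is_two_sum M1 M2 p N.
Proof.
move=> indN c1 c2; have [l1 l1'] := U2_loop_coloop indM1 c1 pM1.
have [l2 l2'] := U2_loop_coloop indM2 c2 pM2; split=> // C.
rewrite !(U2_circuitE _ indM1) !(U2_circuitE _ indM2); split.
  move=> /[dup]/circuit_dep[sC nC] /minsetP[_ minC].
  have pC : p \notin C by apply: contra pN; apply: subsetP.
  (* Three elements of [C] on one line are already dependent, so by minimality they are all of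
     [C]. *)
  have [|le1] := ltnP 2 #|C :&: ground M1|.
    case/card_sub_ex=> D; rewrite subsetI => /andP[sDC sD1] cD; apply: Or31.
    have <- : D = C; last by rewrite sD1 cD (contra (subsetP sDC p)).
    apply: minC => //; rewrite (subset_trans sDC sC) indN ?(subset_trans sDC sC) //.
    by rewrite (setIidPl sD1) cD.
  have [|le2] := ltnP 2 #|C :&: ground M2|.
    case/card_sub_ex=> D; rewrite subsetI => /andP[sDC sD2] cD; apply: Or32.
    have <- : D = C; last by rewrite sD2 cD (contra (subsetP sDC p)).
    apply: minC => //; rewrite (subset_trans sDC sC) indN ?(subset_trans sDC sC) //.
    by rewrite (setIidPl sD2) cD andbF.
  move: nC; rewrite indN // le1 le2 /= (card_parts sC) => c4.
  apply: Or33; exists (p |: (C :&: ground M1)), (p |: (C :&: ground M2)).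
  rewrite (U2_circuitE _ indM1) (U2_circuitE _ indM2) !subUset !sub1set pM1 pM2.
  rewrite !subsetIr !cardsU1 !inE eqxx !(negPf pC) /=.
  split=> //; try by move: le1 le2 c4; clear; lia.
  rewrite setUACA setUid -setIUr setU1K; last by rewrite !inE (negPf pC).
  apply/esym/setIidPl; apply: subset_trans sC _.
  by rewrite groundN subsetDl.
have minimal m : C \subset ground N -> C \notin indep N -> #|C| <= m ->
    (forall D, D \subset C -> D \notin indep N -> m <= #|D|) -> circuit N C.
  move=> sC nC cC minC; apply/minsetP; rewrite sC nC; split=> // D /andP[_ nD] sD.
  by apply/eqP; rewrite eqEcard sD (leq_trans cC) ?minC.
have three D : D \subset ground N -> D \notin indep N -> 3 <= #|D|.
  move=> sD; rewrite indN //; apply: contraNT; rewrite -leqNgt => cD.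
  by rewrite !(leq_trans (subset_leq_card (subsetIl D _)) cD) leqW.
case=> [[/andP[sC /eqP cC] pC]|[/andP[sC /eqP cC] pC]|].
- have sCN : C \subset ground N by rewrite groundN subsetD1 pC subsetU ?sC.
  apply: (minimal 3) => //; rewrite ?cC // ?indN ?(setIidPl sC) ?cC //.
  by move=> D sD; apply: three; apply: subset_trans sCN.
- have sCN : C \subset ground N by rewrite groundN subsetD1 pC subsetU ?sC ?orbT.
  apply: (minimal 3) => //; rewrite ?cC // ?indN ?(setIidPl sC) ?cC ?andbF //.
  by move=> D sD; apply: three; apply: subset_trans sCN.
case=> C1 [C2 [cC1 p1 cC2 p2 eC]].
have := circuit_parts cC1 p1 cC2 p2; rewrite -eC => -[sC e1 e2].
have cC : #|C| = 4 by rewrite card_parts // e1 e2.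
(* A subset of [C] has at most two points on each line, so if dependent it has more than three
   elements. *)
apply: (minimal 4); rewrite ?indN ?cC ?andbF // => D sD.
rewrite indN ?(subset_trans sD sC) // -{1}e1 -{1}e2 !subset_leq_card ?setSI //=.
by rewrite -ltnNge.
Qed.

(** Here [N] is known only through its circuits. Two points of one line and one of the other, all
    distinct from [p], form a base. *)
Lemma two_sum_rk : 3 <= #|ground M1| -> 3 <= #|ground M2| ->
  is_two_sum M1 M2 p N -> rk N = 3.
Proof.
move=> c1 c2 [_ _ _ _ circN].
have [|D1 sD1 cD1] := @card_sub_ex _ (ground M1 :\ p) 2.
  by move: c1; rewrite (cardsD1 p) pM1.
have [|D2 sD2 cD2] := @card_sub_ex _ (ground M2 :\ p) 1.
  by move: c2; rewrite (cardsD1 p) pM2 => /ltnW.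
have sDN : D1 :|: D2 \subset ground N by rewrite groundN setDUl setUSS.
have [[s1 _] [s2 _]] : (D1 \subset ground M1 /\ p \notin D1) /\
    (D2 \subset ground M2 /\ p \notin D2).
  by move: sD1 sD2; rewrite !subsetD1 => /andP[-> ->] /andP[-> ->].
have cD : #|D1 :|: D2| <= 3 by rewrite (leq_trans (leq_card_setU _ _).1) ?cD1 ?cD2.
have l1 : #|D1| <= #|(D1 :|: D2) :&: ground M1|.
  by rewrite subset_leq_card // subsetI subsetUl.
have l2 : #|D2| <= #|(D1 :|: D2) :&: ground M2|.
  by rewrite subset_leq_card // subsetI subsetUr.
have g1 : [/\ #|(D1 :|: D2) :&: ground M1| <= 2, #|(D1 :|: D2) :&: ground M2| <= 2 &
    3 = #|D1 :|: D2|].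
  by move: l1 l2 cD; rewrite cD1 cD2 (card_parts sDN); clear; split; lia.
apply/eqP; rewrite eqn_leq; apply/andP; split; last first.
  case: g1 => g1 g2 ->.
  rewrite indep_rank //; apply: contraT => nD.
  have [C /circN cC sC] := circuit_sub_ex sDN nD.
  have sI g : #|C :&: g| <= #|(D1 :|: D2) :&: g| by rewrite subset_leq_card ?setSI.
  (* A circuit needs three points on one line or four in all, which [D1 :|: D2] does not have. *)
  case: cC => [[]|[]|[C1 [C2 [cC1 p1 cC2 p2 eC]]]].
  - rewrite U2_circuitE // => /andP[sC1 /eqP cC] _.
    by have := sI (ground M1); rewrite (setIidPl sC1) cC ltnNge ?g1 ?g2.
  - rewrite U2_circuitE // => /andP[sC1 /eqP cC] _.
    by have := sI (ground M2); rewrite (setIidPl sC1) cC ltnNge ?g1 ?g2.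
  have := circuit_parts cC1 p1 cC2 p2; rewrite -eC => -[sCN e1 e2].
  have := leq_trans (subset_leq_card sC) cD; rewrite (card_parts sCN) e1 e2.
  by clear; lia.
rewrite /rk; have [J [iJ sJ <-]] := rank_indepE N (ground N).
rewrite leqNgt; apply/negP => cJ.
have pJ : p \notin J by apply: contra pN; apply: subsetP.
have nocirc C : circuit N C -> ~~ (C \subset J).
  by case/circuit_dep=> _; apply: contra; apply: indepS.
have le1 : #|J :&: ground M1| <= 2.
  rewrite leqNgt; apply/negP => /card_sub_ex[D].
  rewrite subsetI => /andP[sDJ sD] cardD; suff /nocirc : circuit N D by rewrite sDJ.
  by apply/circN/Or31; rewrite U2_circuitE // sD cardD (contra (subsetP sDJ p)).
have le2 : #|J :&: ground M2| <= 2.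
  rewrite leqNgt; apply/negP => /card_sub_ex[D].
  rewrite subsetI => /andP[sDJ sD] cardD; suff /nocirc : circuit N D by rewrite sDJ.
  by apply/circN/Or32; rewrite U2_circuitE // sD cardD (contra (subsetP sDJ p)).
rewrite (card_parts sJ) in cJ.
(* An independent set of more than three elements has exactly two on each line; adding [p] to each
   pair gives two circuits whose combination is contained in [J]. *)
set C := ((p |: (J :&: ground M1)) :|: (p |: (J :&: ground M2))) :\ p.
suff /nocirc : circuit N C.
  rewrite /C setUACA setUid -setIUr setU1K; first by rewrite subsetIl.
  by rewrite !inE (negPf pJ).
apply/circN/Or33; exists (p |: (J :&: ground M1)), (p |: (J :&: ground M2)).
rewrite !U2_circuitE // !subUset !sub1set pM1 pM2 !subsetIr !cardsU1 !inE eqxx.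
by rewrite !(negPf pJ) /=; split=> //; move: le1 le2 cJ; clear; lia.
Qed.

End TwoSumLines.

(** Extending each line by the new point [None] gives two uniform matroids on k + 1 elements that
    share only this basepoint. *)
Lemma lines_isomorphic_two_sum (T : finType) (M : matroid T) (L L' : {set T}) k :
  2 <= k -> #|L| = k -> #|L'| = k -> [disjoint L & L'] -> ground M = L :|: L' ->
  (forall I : {set T}, I \subset ground M -> (I \in indep M) =
    [&& #|I :&: L| <= 2, #|I :&: L'| <= 2 & #|I| <= 3]) ->
  isomorphic_two_sum M (uniform 2 k.+1) (uniform 2 k.+1).
Proof.
move=> k2 cL cL' dL EL indM.
pose g (A : {set T}) : {set option T} := None |: Some @: A.
have injS : injective (@Some T) by move=> x y [].
have gI (A B : {set T}) : Some @: A :&: g B = Some @: (A :&: B).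
  by rewrite /g setIUr imsetI; [rewrite -[RHS]set0U; congr (_ :|: _);
    apply/setP=> x; rewrite !inE; apply/andP => -[/imsetP[y _ ->]] | move=> x y _ _ []].
have nS (A : {set T}) : None \notin Some @: A by apply/imsetP => -[].
have gC (A : {set T}) : #|A| = k -> #|g A| = k.+1.
  by rewrite /g cardsU1 nS card_imset // => ->.
have indU (A I : {set option T}) : I \subset ground (uniform_on 2 A) ->
    (I \in indep (uniform_on 2 A)) = (#|I| <= 2) by rewrite /= inE => ->.
exists (option T), (uniform_on 2 (g L)), (uniform_on 2 (g L')), (lift_matroid M), None.
split; last exact: isomorphic_lift.
- by apply/isomorphic_uniformP; split; [rewrite /= gC | exact: indU].
- by apply/isomorphic_uniformP; split; [rewrite /= gC | exact: indU].
apply: (lines_two_sum (indU _) (indU _)); rewrite /= ?gC //.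
- apply/setP=> -[x|]; rewrite !inE //= !(mem_imset _ _ injS).
  by apply/andP => -[xL]; rewrite (disjointFr dL).
- by rewrite /g setUACA setUid -imsetU -EL setU1K.
move=> _ /subset_imset_ex[I sI ->].
rewrite lift_indepE indM // !gI !card_imset //.
Qed.

(** * The bound and the characterisation of equality *)

Unset Implicit Arguments.

Theorem theorem1p2 (T : finType) (k : nat) (M : matroid T)
    (hk : 4 <= k) (hsimple : simple M) (hdeg : minimally_degenerate k M) :
  #|ground M| <= (k - 1) * (rk M - 1) + 2 /\
  (#|ground M| = (k - 1) * (rk M - 1) + 2 <->
     isomorphic M (uniform 2 (k + 1)) \/
     isomorphic_two_sum M (uniform 2 (k + 1)) (uniform 2 (k + 1))).
Proof.
have [r2 bound] := ground_count hk hsimple hdeg.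
have rE : k.-1 * rk M = (k - 1) * (rk M - 1) + k.-1.
  by rewrite !subn1 addnC -mulnS prednK // ltnW.
split; first by move: bound; rewrite rE; clear; lia.
rewrite addn1; split=> [cardM|].
  have cardE : #|ground M| + k.-1 = k.-1 * rk M + 2.
    by rewrite rE cardM; clear; lia.
  move: r2; rewrite leq_eqVlt => /orP[/eqP r2|r3]; [left|right].
    apply/isomorphic_uniformP; split; first by rewrite cardM -r2; move: hk; clear; lia.
    move=> A sA; apply/idP/idP => [iA|]; last exact: simple_indep2.
    by rewrite r2 indep_rank.
  have [L [L' [tL tL' dL EL]]] := ground_two_lines hk hsimple hdeg cardE r3.
  have cL := tight_line_card hk tL; have cL' := tight_line_card hk tL'.
  (* Two disjoint lines give |E| = 2k, and (k - 1)(r - 1) + 2 takes this value only at r = 3. *)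
  have r3E : rk M = 3.
    move: cardE; rewrite EL cardsU (disjoint_setI0 dL) cards0 cL cL' subn0.
    case: (rk M) r3 => [|[|[|[|m]]]] // _.
    by rewrite !mulnS; have := leq0n (k.-1 * m); move: hk; clear; lia.
  apply: (lines_isomorphic_two_sum _ cL cL' dL EL); first by rewrite ltnW // ltnW.
  by move=> I sI; apply: (two_lines_indepE hk hsimple hdeg cardE tL tL' dL EL r3E sI).
case=> [/[dup]/isomorphic_uniformP[cM indM] _|].
  by rewrite (U2_rk indM) cM; move: hk; clear; lia.
case=> T' [M1 [M2 [N [p [iso1 iso2]]]]].
case/isomorphic_uniformP: iso1 => c1 ind1; case/isomorphic_uniformP: iso2 => c2 ind2.
move=> sumN /isomorphic_rk[-> ->]; have [meetp _ _ gN _] := sumN.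
rewrite (two_sum_rk ind1 ind2 meetp gN _ _ sumN) ?c1 ?c2; try by move: hk; clear; lia.
have pU : p \in ground M1 :|: ground M2.
  by have := set11 p; rewrite -meetp !inE => /andP[->].
(* The 2-sum has 2(k + 1) - 2 = 2k elements, which is the bound in rank 3. *)
have := cardsUI (ground M1) (ground M2); rewrite meetp cards1 c1 c2 gN.
by rewrite (cardsD1 p) pU; move: hk; clear; lia.
Qed.
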